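(* Let $k\ge 1$ and $f:\mathbb{N}\times\mathbb{N}\to\mathbb{N}$. Let $G$ be a group, $A\subseteq G$ a $k$-stable subset, $\mathcal{F}$ a bi-invariant Boolean algebra of subsets of $G$ containing $A$, and $\mu$ a bi-invariant finitely additive probability measure on $\mathcal{F}$. Then there exist $n\le\Psi_1(f)$ and $m\le\Psi_2(f)$ such that $\mathrm{Stab}_m(A)\in\mathcal{F}$, $\mathrm{Stab}_m(A)$ is a subgroup of $G$, and $\mathrm{Stab}_m(A)$ has index at most $n$ in $G$. In addition, there exists a subset $Y\subseteq G$, which is a union of cosets of $\mathrm{Stab}_m(A)$, such that $\mu(A\mathbin{\triangle}Y)\le 2^{-f(n,m)}$. Here $$\Psi_2(f):=\Phi(e_f),\qquad \Psi_1(f):=\Psi\bigl(C_{\Psi_2(f)}\bigr),$$ $$e_f(m):=\max\Bigl\{3\max_{n\le\Psi(C_m)}f(n,m)+3\lceil\log_2\Psi(C_m)\rceil+\lceil\log_2(k-1)\rceil+5,\ m+1\Bigr\},$$ where $C_m:\mathbb{N}\to\mathbb{N}$ is the constant function with value $m$, and $\Phi,\Psi$ are the functionals (depending on $k$) defined in the context.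
   Context: $\mathbb{N}$ contains $0$. $A\subseteq G$ is $k$-stable if there are no $a_1,\dots,a_k,b_1,\dots,b_k\in G$ such that for all $1\le i,j\le k$: $a_ib_j\in A\leftrightarrow i\le j$. A Boolean algebra $\mathcal{F}$ of subsets of $G$ is bi-invariant if it is closed under $B\mapsto gB$ and $B\mapsto Bg$ for all $g\in G$; $\mu$ on $\mathcal{F}$ is bi-invariant if $\mu(gB)=\mu(B)=\mu(Bg)$. $\mathrm{Stab}_m(A):=\{g\in G:\mu(Ag\mathbin{\triangle}A)\le2^{-m}\}$. Cosets of a subgroup $H$ are left cosets $gH$. Let $R(x,y)$ be the usual two-colour Ramsey number for graphs and $s:=R(R(k,k+1),R(k,k+1))+1$. For $f:\mathbb{N}\to\mathbb{N}$ let $f_M(n):=\max_{i\le n}f(i)$, $\tilde f(n):=n+5+2f_M(n+1)+\lceil\log_2(s-1)\rceil$, and $\Phi(f):=\tilde f^{(s)}(0)$, where $\tilde f^{(s)}$ is the $s$-th iterate of $\tilde f$. Let $\omega_{d}(m):=(80d)^{d}2^{20md}$ (with $0^0=1$). For $e:\mathbb{N}\to\mathbb{N}$ let $f_e(n):=e(\omega_{k-1}(n))$ and $\Psi(e):=\omega_{k-1}(\Phi(f_e))$. When $k=1$ the term $\lceil\log_2(k-1)\rceil$ is read as $0$. *)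

(* Defs.v *)
From HB Require Import structures.
From mathcomp Require Import all_boot all_order all_algebra.
From mathcomp Require Import all_classical all_reals all_analysis.

Set Implicit Arguments.
Unset Strict Implicit.
Unset Printing Implicit Defensive.

Import Order.TTheory GRing.Theory Num.Theory.

Local Open Scope classical_set_scope.
Local Open Scope nat_scope.

Section Groups.
Variable G : groupType.
Implicit Types (A H Y : set G) (F : set (set G)).

Definition ltrans (g : G) A : set G := [set (g * x)%g | x in A].
Definition rtrans A (g : G) : set G := [set (x * g)%g | x in A].

Definition kstable (k : nat) A : Prop :=
  ~ exists a b : 'I_k -> G, forall i j : 'I_k, A (a i * b j)%g <-> i <= j.

Definition biinvariant_algebra F : Prop :=
  [/\ F set0, setU_closed F, setC_closed F,
      (forall g B, F B -> F (ltrans g B)) &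
      (forall g B, F B -> F (rtrans B g))].

(* The values of mu outside F are unconstrained. *)
Definition biinvariant_probability (R : realType) F (mu : set G -> R) : Prop :=
  [/\ (forall B, F B -> (0 <= mu B)%R),
      mu setT = 1%R,
      (forall B C, F B -> F C -> B `&` C = set0 ->
         mu (B `|` C) = (mu B + mu C)%R),
      (forall g B, F B -> mu (ltrans g B) = mu B) &
      (forall g B, F B -> mu (rtrans B g) = mu B)].

Definition Stab (R : realType) (mu : set G -> R) (m : nat) A : set G :=
  [set g | (mu (rtrans A g `+` A) <= 2 ^- m)%R].

Definition is_subgroup H : Prop := group_closed [in H].

Definition lcosets_of H : set (set G) := [set ltrans g H | g in [set: G]].

Definition index_at_most (n : nat) H : Prop := (lcosets_of H #<= `I_n)%card.

Definition union_of_lcosets H Y : Prop :=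
  exists2 D : set (set G), D `<=` lcosets_of H & Y = \bigcup_(B in D) B.

End Groups.

Section Ramsey.

(* Colouring the pairs of distinct vertices by the truth value of e; the
   diagonal of e plays no role. *)
Definition clique (T : finType) (e : rel T) (S : {set T}) : Prop :=
  {in S &, forall u v, u != v -> e u v}.
Definition coclique (T : finType) (e : rel T) (S : {set T}) : Prop :=
  {in S &, forall u v, u != v -> ~~ e u v}.

Definition ramsey_prop (x y N : nat) : Prop :=
  forall e : rel 'I_N, symmetric e ->
    (exists2 S : {set 'I_N}, #|S| = x & clique e S) \/
    (exists2 S : {set 'I_N}, #|S| = y & coclique e S).

Lemma ramsey_in (x y : nat) : exists N : nat,
  forall (T : finType) (e : rel T) (V : {set T}), symmetric e -> N <= #|V| ->
    (exists S : {set T}, [/\ S \subset V, #|S| = x & clique e S]) \/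
    (exists S : {set T}, [/\ S \subset V, #|S| = y & coclique e S]).
Proof.
elim: x y => [|x IHx] y.
  exists 0 => T e V _ _; left; exists finset.set0.
  by rewrite finset.sub0set cards0; split=> // u v; rewrite finset.in_set0.
elim: y => [|y [N2 IHy]].
  exists 0 => T e V _ _; right; exists finset.set0.
  by rewrite finset.sub0set cards0; split=> // u v; rewrite finset.in_set0.
have [N1 {}IHx] := IHx y.+1.
exists (N1 + N2).+1 => T e V sym leV.
have /card_gt0P[v vV] : 0 < #|V| by exact: leq_trans leV.
pose P := [set u in V :\ v | e v u]%SET.
pose Q := [set u in V :\ v | ~~ e v u]%SET.
have cV : #|V| = (#|P| + #|Q|).+1.
  rewrite (cardsD1 v) vV add1n; congr _.+1.
  rewrite -(cardsID [set u | e v u]%SET (V :\ v)%SET); congr (_ + _);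
    apply: eq_card => u; rewrite !finset.inE //.
  by case: (e v u); rewrite ?andbF ?andbT.
have PV : P \subset V by apply/fintype.subsetP => u; rewrite !finset.inE => /andP[/andP[]].
have QV : Q \subset V by apply/fintype.subsetP => u; rewrite !finset.inE => /andP[/andP[]].
have vP : v \notin P by rewrite !finset.inE eqxx.
have vQ : v \notin Q by rewrite !finset.inE eqxx.
have sub (S W : {set T}) : S \subset W -> W \subset V -> (v |: S)%SET \subset V.
  move=> SW WV; rewrite finset.subUset finset.sub1set vV.
  exact: fintype.subset_trans WV.
have notS (S W : {set T}) : S \subset W -> v \notin W -> #|(v |: S)%SET| = #|S|.+1.
  by move=> SW vW; rewrite cardsU1 (contra (fintype.subsetP SW v) vW).
have [le1|lt1] := leqP N1 #|P|.
  case: (IHx T e P sym le1) => [[S [SP cS eS]]|[S [SP cS eS]]]; last first.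
    by right; exists S; split=> //; exact: fintype.subset_trans PV.
  left; exists (v |: S)%SET; split; [exact: sub PV|by rewrite (notS S P) ?cS|].
  have eP u : u \in S -> e v u by move/(fintype.subsetP SP); rewrite !finset.inE => /andP[].
  move=> u w /setU1P[->|uS] /setU1P[->|wS]; rewrite ?eqxx // => uw.
  - exact: eP.
  - by rewrite sym; exact: eP.
  - by apply: eS.
have le2 : N2 <= #|Q|.
  by move: leV; rewrite cV ltnS => leV; rewrite -(leq_add2l N1) (leq_trans leV) // leq_add2r ltnW.
case: (IHy T e Q sym le2) => [[S [SQ cS eS]]|[S [SQ cS eS]]].
  by left; exists S; split=> //; exact: fintype.subset_trans QV.
right; exists (v |: S)%SET; split; [exact: sub QV|by rewrite (notS S Q) ?cS|].
have eQ u : u \in S -> ~~ e v u by move/(fintype.subsetP SQ); rewrite !finset.inE => /andP[].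
move=> u w /setU1P[->|uS] /setU1P[->|wS]; rewrite ?eqxx // => uw.
- exact: eQ.
- by rewrite sym; exact: eQ.
- by apply: eS.
Qed.

Lemma ramsey_exists (x y : nat) : exists N : nat, `[< ramsey_prop x y N >].
Proof.
have [N HN] := ramsey_in x y; exists N; apply/asboolP => e sym.
case: (HN _ e [set: 'I_N]%SET sym); first by rewrite cardsT card_ord.
  by case=> S [_ cS eS]; left; exists S.
by case=> S [_ cS eS]; right; exists S.
Qed.

Definition ramsey (x y : nat) : nat := ex_minn (ramsey_exists x y).

End Ramsey.

Section Bounds.
Variable k : nat.

Definition ramsey_s : nat :=
  (ramsey (ramsey k k.+1) (ramsey k k.+1)).+1.

Definition fmax (f : nat -> nat) (n : nat) : nat := \max_(i < n.+1) f i.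

(* up_log 2 x is the ceiling of log_2 x, and up_log 2 0 = 0. *)
Definition ftilde (f : nat -> nat) (n : nat) : nat :=
  n + 5 + 2 * fmax f n.+1 + up_log 2 (ramsey_s - 1).

Definition Phi (f : nat -> nat) : nat := iter ramsey_s (ftilde f) 0.

Definition omega (d m : nat) : nat := (80 * d) ^ d * 2 ^ (20 * m * d).

Definition Psi (e : nat -> nat) : nat :=
  omega (k - 1) (Phi (fun n => e (omega (k - 1) n))).

Definition PsiC (m : nat) : nat := Psi (fun=> m).

Definition ef (f : nat -> nat -> nat) (m : nat) : nat :=
  maxn (3 * (\max_(n < (PsiC m).+1) f n m) + 3 * up_log 2 (PsiC m)
          + up_log 2 (k - 1) + 5)
       m.+1.

Definition Psi2 (f : nat -> nat -> nat) : nat := Phi (ef f).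

Definition Psi1 (f : nat -> nat -> nat) : nat := PsiC (Psi2 f).

End Bounds.

(* Main.v *)
Require Import Defs.
From mathcomp Require Import all_boot all_order all_algebra.
From mathcomp Require Import all_classical all_reals all_analysis.
From mathcomp Require Import zify lra.

(** Call drift of g the measure of the set of points x with x g in A and x not
    in A; it is half the measure of the symmetric difference of A g and A.  The
    proof plays stability, which forbids half graphs, against the measure,
    which produces them.

    Suppose that every point x of a set E is related to a set of z of measure
    at least delta, while every single z is related to a small part of E only.
    Choose points of E one after the other, each unrelated to a witness, fixed
    in advance, of every nonempty intersection of K earlier sections.  After
    about K/delta steps some z is related to K of the chosen points, and these
    points together with the witnesses of their initial segments form a half
    graph of size K.  This is [ladder_exists], with its measured form
    [measure_ladder].  So a stable relation cannot have large sections on one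
    side and tiny sections on the other; this takes the place of an exchange
    of integrals.  It is applied to membership of x z in A, and to the relation
    [gap] which defines the differences A g \ A h; by Ramsey's theorem the
    latter has no half graph of size K = R(k,k+1) ([kstable_gap]).

    Stabilization.  Let D_i be the set of points moved out of A by h_i.  If the
    drifts of h_0, ..., h_{K-1} are positive and decrease fast enough, then
    right translates of the D_i can be chosen so that each one meets the
    intersection of the previous ones in a set larger than all the later D_j
    together ([moved_meets]).  Points in the first i translates and in no later
    one then form a forbidden half graph ([no_fast_decay]).  If Stab_m differed
    from Stab_(e m) for all m <= Phi(e), then each of the s steps in the
    definition of Phi would yield an element whose drift is bounded by the
    square of the previous drift.  Since R(K,K) > (K-1)^2, one may keep every
    (K-1)-st of them and obtain K drifts which decrease fast enough
    ([metastable_Stab]).  Hence Stab_m = Stab_(e m) for some m <= Phi(e); the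
    drift is subadditive and e m > m, so this set is a subgroup H.

    Membership in the algebra.  By the same principle finitely many points
    detect all differences A g \ A h of measure above a given bound
    ([finite_net]), so H is a finite union of intersections of translates of A.

    Index.  Cosets of H correspond to translates of A that are 2^-m apart.
    A moderate number of well-chosen points tells finitely many of them apart,
    and a Sauer-Shelah bound for stable relations limits the number of traces
    on these points ([size_patterns], [packing]).

    Approximation.  Elements of H have drift at most 2^-(e m).  In a coset of H
    one of A and its complement has at least half of the measure; if the other
    one were not tiny, the pairs (x, h) with x on the minority side and x h on
    the majority side would again violate stability ([minority_in_coset]).  Let
    Y be the union of the cosets in which A has the majority. *)

Set Implicit Arguments.
Unset Strict Implicit.
Unset Printing Implicit Defensive.

Import Order.TTheory GRing.Theory Num.Theory.

Local Open Scope classical_set_scope.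
Local Open Scope nat_scope.

(** * Half graphs from greedy choices *)

Section Ladders.
Variables (X Z : choiceType).
Implicit Types (P : X -> Z -> Prop) (E : X -> Prop) (xs l : seq X).

(** A half graph of size K, in the decreasing order that the greedy choice below
    produces. *)
Definition ladder K P (a : 'I_K -> X) (c : 'I_K -> Z) :=
  forall i j : 'I_K, P (a i) (c j) <-> j <= i.

Fixpoint words K xs : seq (seq X) :=
  if K is K'.+1 then [seq x :: l | x <- xs, l <- words K' xs] else [:: [::]].

Lemma size_words K xs : size (words K xs) = size xs ^ K.
Proof. by elim: K => //= K IH; rewrite size_allpairs IH expnS. Qed.

Lemma mem_words xs l : {subset l <= xs} -> l \in words (size l) xs.
Proof.
elim: l => //= x l IH lxs; apply/allpairsP; exists (x, l).
split=> //=; first by apply: lxs; rewrite mem_head.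
by apply: IH => y yl; apply: lxs; rewrite inE yl orbT.
Qed.

(** A choice of a common right neighbour of [l], made once and for all: points
    chosen later have to avoid it. *)
Definition witness P (z0 : Z) l : Z := xget z0 [set z | forall x, x \in l -> P x z].

Lemma witnessP P z0 l z : (forall x, x \in l -> P x z) ->
  forall x, x \in l -> P x (witness P z0 l).
Proof. by move=> Pz; exact: (xgetI z0 (Pz : [set z | forall x, x \in l -> P x z] z)). Qed.

(** The last chosen point is the head.  Lists [l] of exactly K entries, with
    repetitions, stand for the nonempty sets of at most K earlier points. *)
Fixpoint avoiding P E z0 K xs : Prop :=
  if xs is x :: xs' then
    [/\ E x,
        forall l, size l = K -> {subset l <= xs'} -> ~ P x (witness P z0 l) &
        avoiding P E z0 K xs']
  else True.

Lemma avoiding_subseq P E z0 K ys xs :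
  subseq ys xs -> avoiding P E z0 K xs -> avoiding P E z0 K ys.
Proof.
elim: xs ys => [|x xs IH] [|y ys] //=.
case: eqP => [->|_] sub [Ex Ax Axs]; last exact: (IH (y :: ys)).
split=> //; last exact: IH.
by move=> l lK lys; apply: Ax => // u /lys; apply: (mem_subseq sub).
Qed.

Lemma avoiding_exists P E z0 K n :
  (forall zs : seq Z, size zs <= n ^ K ->
     exists2 x, E x & forall z, z \in zs -> ~ P x z) ->
  exists2 xs, size xs = n & avoiding P E z0 K xs.
Proof.
move=> avoid; have: n <= n by [].
elim: {-2}n => [|i IH] lein; first by exists [::].
have [xs xsi Axs] := IH (ltnW lein).
have [|x Ex Px] := avoid [seq witness P z0 l | l <- words K xs].
  rewrite size_map size_words xsi.
  by have [->|K0] := posnP K; rewrite ?expn0// leq_exp2r// ltnW.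
exists (x :: xs) => /=; first by rewrite xsi.
split=> // l lK lxs; apply: Px; apply/map_f; rewrite -lK; exact: mem_words.
Qed.

Lemma avoiding_all P E z0 K xs :
  avoiding P E z0 K xs -> forall x, x \in xs -> E x.
Proof.
elim: xs => //= y xs IH [Ey _ Axs] x; rewrite inE => /orP[/eqP->//|]; exact: IH.
Qed.

(** Among the greedily chosen points keep K which have a common neighbour.  The
    witness of the j-th final segment is related to all points of that segment,
    since they have a common neighbour, and to none of the points chosen after
    it, since these avoid it. *)
Lemma ladder_exists P E K n :
  (forall xs, size xs = n -> (forall x, x \in xs -> E x) ->
     exists z, K <= count (fun x => `[< P x z >]) xs) ->
  (forall zs : seq Z, size zs <= n ^ K ->
     exists2 x, E x & forall z, z \in zs -> ~ P x z) ->
  exists (a : 'I_K -> X) (c : 'I_K -> Z), ladder P a c.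
Proof.
move=> common avoid.
have [x0 Ex0 _] := avoid [::] isT.
have [z0 _] : exists z0 : Z, True.
  have [|z _] := common (nseq n x0) (size_nseq _ _); last by exists z.
  by move=> x /nseqP[->].
have [xs xsn Axs] := @avoiding_exists P E z0 K n avoid.
have [z zK] := common xs xsn (avoiding_all Axs).
pose fs := [seq x <- xs | `[< P x z >]].
pose ys := drop (size fs - K) fs.
have ysK : size ys = K by rewrite size_drop subKn// size_filter.
have Ays : avoiding P E z0 K ys.
  apply: avoiding_subseq Axs; apply: subseq_trans (filter_subseq _ _).
  exact: drop_subseq.
have Pz x : x \in ys -> P x z.
  by move/mem_drop; rewrite mem_filter => /andP[/asboolP].
(* The entries of ys from j on, padded with copies of the j-th entry. *)
pose l (j : 'I_K) := mkseq (fun t => nth x0 ys (maxn j t)) K.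
exists (fun i => nth x0 ys i), (fun j => witness P z0 (l j)) => i j.
split=> [|leji]; last first.
  apply: (@witnessP P z0 (l j) z) => [x /mapP[t]|].
    rewrite mem_iota add0n => /andP[_ tK] ->; apply/Pz/mem_nth.
    by rewrite ysK gtn_max tK ltn_ord.
  apply/mapP; exists (i : nat); first by rewrite mem_iota add0n ltn_ord.
  by rewrite (maxn_idPr leji).
apply: contraPT; rewrite -ltnNge => ltij.
have: avoiding P E z0 K (drop i ys) by apply: avoiding_subseq Ays; exact: drop_subseq.
rewrite (drop_nth x0) ?ysK//= => -[_ + _]; apply; first by rewrite size_mkseq.
move=> x /mapP[t]; rewrite mem_iota add0n => /andP[_ tK] ->.
have lem : i.+1 <= maxn j t by rewrite (leq_trans ltij)// leq_maxl.
rewrite -[maxn j t](subnKC lem) -nth_drop mem_nth// size_drop ysK.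
by rewrite ltn_sub2r ?(leq_ltn_trans ltij)// gtn_max ltn_ord.
Qed.

End Ladders.

(** * Ramsey numbers and stable differences *)

Section RamseyBounds.

Lemma ramseyP x y : ramsey_prop x y (ramsey x y).
Proof. by rewrite /ramsey; case: ex_minnP => N /asboolP. Qed.

(** The graph without edges has no clique of size k > 1. *)
Lemma ramsey_gt k : 1 < k -> k < ramsey k k.+1.
Proof.
move=> k1; have [|[S Sk eS]|[S Sk _]] := @ramseyP k k.+1 (fun _ _ => false) => //.
  have /card_gt1P[u [v [uS vS uv]]] : 1 < #|S| by rewrite Sk.
  by have := eS u v uS vS uv.
by have := max_card (mem S); rewrite Sk card_ord.
Qed.

(** A disjoint union of K - 1 cliques of size K - 1 has neither a clique nor a
    coclique of size K. *)
Lemma ramsey_gt_sqr K : 1 < K -> (K - 1) ^ 2 < ramsey K K.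
Proof.
move=> K1; rewrite ltnNge; apply/negP => leN.
have K0 : 0 < K - 1 by rewrite subn_gt0.
pose e (u v : 'I_(ramsey K K)) := u %/ (K - 1) == v %/ (K - 1).
(* A set injected below K - 1 is too small; cliques inject by residues modulo
   K - 1, cocliques by quotients. *)
have small (S : {set 'I_(ramsey K K)}) (f : 'I_(ramsey K K) -> nat) :
    (forall u, f u < K - 1) -> {in S &, injective f} -> #|S| <> K.
  move=> fK finj SK; pose g u : 'I_(K - 1) := Ordinal (fK u).
  have ginj : {in S &, injective g}.
    by move=> u v uS vS /(congr1 val)/=; exact: finj.
  have := max_card (mem (g @: S)%SET).
  by rewrite card_in_imset// card_ord SK; lia.
have [|[S SK eS]|[S SK eS]] := @ramseyP K K e.
- by move=> u v; rewrite /e eq_sym.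
- apply: (small S (fun u => u %% (K - 1))) SK => [u|u v uS vS /= uv].
    by rewrite ltn_mod.
  case: (eqVneq u v) => // /(eS u v uS vS)/eqP uvd; apply: val_inj => /=.
  by rewrite (divn_eq u (K - 1)) (divn_eq v (K - 1)) uv uvd.
- apply: (small S (fun u => u %/ (K - 1))) SK => [u|u v uS vS /= uv].
    rewrite ltn_divLR// (leq_trans (ltn_ord u))// (leq_trans leN)//.
  by case: (eqVneq u v) => // /(eS u v uS vS)/eqP.
Qed.

Lemma ord_set_enum N k (S : {set 'I_N}) : #|S| = k ->
  exists s : 'I_k -> 'I_N,
    (forall i, s i \in S) /\ (forall i j, (s i < s j) = (i < j)).
Proof.
move=> <-; exists (fun i => enum_val i); split=> [i|]; first exact: enum_valP.
have mono (i j : 'I_#|S|) : i < j -> enum_val i < enum_val j.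
  move=> ij; pose x0 := enum_val i.
  rewrite !(enum_val_nth x0) -!(nth_map x0 0 val) -?cardE//.
  apply: (sorted_ltn_nth ltn_trans) => //; rewrite ?inE ?size_map -?cardE//.
  rewrite sorted_map /enum_mem; apply: sorted_filter => [? ? ?|].
    exact: ltn_trans.
  rewrite -enumT -sorted_map val_enum_ord; exact: iota_ltn_sorted.
move=> i j; have [/mono//|ji|/val_inj->] := ltngtP i j; last by rewrite ltnn.
by have := mono _ _ ji; case: ltngtP.
Qed.

End RamseyBounds.

Section StableDifferences.
Variables (G : groupType) (A : set G).

(** [gap x (g, h)] says that x lies in A g^-1 but not in A h^-1. *)
Definition gap (x : G) (q : G * G) : Prop := A (x * q.1)%g /\ ~ A (x * q.2)%g.

(** In a half graph for the differences, colour a pair i < j according to whether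
    a_i (c_j).1 is in A.  If it never is on k indices, the first components
    give a half graph for A.  If it always is on k + 1 indices, then so is
    a_i (c_j).2 for i < j, and not for j <= i; shifting one index gives a half
    graph of size k for the second components. *)
Lemma kstable_gap k (a : 'I_(ramsey k k.+1) -> G) (c : 'I_(ramsey k k.+1) -> G * G) :
  kstable k A -> ~ ladder gap a c.
Proof.
move=> stA lad; set N := ramsey k k.+1 in a c lad.
pose inA (u v : 'I_N) := `[< A (a u * (c v).1)%g >].
pose e (u v : 'I_N) := if u < v then ~~ inA u v else ~~ inA v u.
have [|[S Sk eS]|[S Sk eS]] := @ramseyP k k.+1 (fun u v => if u == v then false else e u v).
- move=> u v; rewrite eq_sym; case: (eqVneq v u) => // vu; rewrite /e.
  by case: ltngtP => // /val_inj uv; rewrite uv eqxx in vu.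
- have [s [sS sm]] := ord_set_enum Sk; apply: stA.
  exists (a \o s \o @rev_ord k), (fun j => (c (s (rev_ord j))).1) => i j /=.
  have -> : (i <= j) = (s (rev_ord j) <= s (rev_ord i)).
    by rewrite [RHS]leqNgt sm/=; have := ltn_ord i; have := ltn_ord j; lia.
  split=> [Aij|/lad[]//]; rewrite leqNgt; apply/negP => ltij.
  have ne : s (rev_ord i) != s (rev_ord j) by rewrite neq_ltn ltij.
  have := eS _ _ (sS _) (sS _) ne; rewrite (negbTE ne) /e ltij => /asboolP.
  exact.
have [s [sS sm]] := ord_set_enum Sk; apply: stA.
exists (fun i => a (s (widen_ord (leqnSn k) i))), (fun j => (c (s (lift ord0 j))).2) => i j.
have -> : (i <= j) = (s (widen_ord (leqnSn k) i) < s (lift ord0 j)).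
  by rewrite sm.
set u := s _; set v := s _; split=> [Aij|ltuv].
  rewrite ltnNge; apply/negP => /lad[] //.
apply: contrapT => nA; have : ~ gap (a u) (c v) by move/lad; rewrite leqNgt ltuv.
apply; split=> //; apply/asboolP; rewrite -[asbool _]negbK.
have ne : u != v by rewrite neq_ltn ltuv.
by have := eS u v (sS _) (sS _) ne; rewrite (negbTE ne) /e ltuv.
Qed.

End StableDifferences.

Lemma ladder_rev (X Z : choiceType) (P : X -> Z -> Prop) K (a : 'I_K -> X) c :
  ladder P a c -> ladder (fun z x => P x z) (c \o @rev_ord K) (a \o @rev_ord K).
Proof. by move=> lad i j /=; rewrite lad /=; have := ltn_ord i; have := ltn_ord j; split; lia. Qed.

(** * A Sauer-Shelah bound for half graphs *)

Section Sauer.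
Variables (X : eqType) (Y : eqType) (P : X -> Y -> bool).
Implicit Types (xs c : seq X) (ys : seq Y).

Definition pattern xs y := [seq P x y | x <- xs].

(** The half graph that replaces a shattered set of size [d]: the points of [c]
    can be switched on one by one. *)
Definition threshold_chain d xs ys := exists c,
  [/\ size c = d, {subset c <= xs} &
      forall j, j <= d -> exists2 y, y \in ys &
        pattern c y = nseq j true ++ nseq (d - j) false].

Lemma pattern_eq xs c y y' : {subset c <= xs} ->
  pattern xs y = pattern xs y' -> pattern c y = pattern c y'.
Proof.
by move=> cxs /eq_in_map e; apply/eq_in_map => x /cxs; exact: e.
Qed.

Lemma pattern_uniq_cons x xs ys b : all (fun y => P x y == b) ys ->
  uniq [seq pattern (x :: xs) y | y <- ys] = uniq [seq pattern xs y | y <- ys].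
Proof.
move=> /allP yb; have inj : injective (cons b) by move=> ? ? [].
rewrite -[RHS](map_inj_uniq inj) -map_comp; congr uniq.
by apply/eq_in_map => y /yb/= /eqP ->.
Qed.

(** Pascal's recursion.  Remove a point x.  The elements of [U] represent the
    traces on the remaining points; those of [C] have a trace which occurs both
    with and without x.  A chain of length d in [C] extends by x to one of
    length d + 1. *)
Lemma size_patterns d xs ys :
  uniq [seq pattern xs y | y <- ys] -> ~ threshold_chain d xs ys ->
  size ys <= if d is d'.+1 then (size xs).+1 ^ d' else 0.
Proof.
elim: xs ys d => [|x xs IH] ys [|d].
- case: ys => // y ys _ []; exists [::]; split=> // j; rewrite leqn0 => /eqP->.
  by exists y; rewrite ?mem_head.
- rewrite exp1n; case: ys => [|y [|y' ys]]//=.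
- case: ys => // y ys _ []; exists [::]; split=> // j; rewrite leqn0 => /eqP->.
  by exists y; rewrite ?mem_head.
move=> uys nch.
pose yt := [seq y <- ys | P x y]; pose yf := [seq y <- ys | ~~ P x y].
have ut : uniq [seq pattern xs y | y <- yt].
  rewrite -(@pattern_uniq_cons x _ _ true).
    by apply: subseq_uniq uys; exact/map_subseq/filter_subseq.
  by apply/allP => y; rewrite mem_filter => /andP[->].
have uf : uniq [seq pattern xs y | y <- yf].
  rewrite -(@pattern_uniq_cons x _ _ false).
    by apply: subseq_uniq uys; exact/map_subseq/filter_subseq.
  by apply/allP => y; rewrite mem_filter => /andP[/negbTE->].
pose both y := pattern xs y \in [seq pattern xs y | y <- yf].
pose C := [seq y <- yt | both y]; pose U := yf ++ [seq y <- yt | ~~ both y].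
have -> : size ys = size U + size C.
  have -> : size ys = size yt + size yf by rewrite !size_filter -(count_predC (P x)).
  have -> : size yt = size C + size [seq y <- yt | ~~ both y].
    by rewrite !(size_filter _ yt) -(count_predC both).
  by rewrite size_cat; lia.
have Cs : {subset C <= ys} by move=> y; rewrite !mem_filter => /and3P[].
have Us : {subset U <= ys}.
  by move=> y; rewrite mem_cat !mem_filter => /orP[/andP[]|/and3P[]].
have leU : size U <= (size xs).+1 ^ d.
  apply: (IH U d.+1).
    rewrite map_cat cat_uniq uf/=; apply/andP; split.
      apply/hasPn => p /mapP[y]; rewrite mem_filter => /andP[+ _] ->.
      by [].
    by apply: subseq_uniq ut; exact/map_subseq/filter_subseq.
  move=> [c [cd cxs cU]]; apply: nch; exists c; split=> // [z /cxs zxs|j /cU[y yU py]].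
    by rewrite inE zxs orbT.
  by exists y => //; exact: Us.
have leC : size C <= if d is d'.+1 then (size xs).+1 ^ d' else 0.
  apply: IH; first by apply: subseq_uniq ut; exact/map_subseq/filter_subseq.
  move=> [c [cd cxs cC]]; apply: nch; exists (x :: c); split=> /=; first by rewrite cd.
    by move=> z; rewrite !inE => /orP[->//|/cxs->]; rewrite orbT.
  move=> [_|j jd].
    have [y] := cC 0 isT; rewrite mem_filter => /andP[/mapP[y' y'f e] _] py.
    move: y'f; rewrite mem_filter => /andP[/negbTE Py' y'ys]; exists y' => //=.
    by rewrite Py' -/(pattern c y') -(pattern_eq cxs e) py !subn0.
  have [y yC py] := cC j jd; exists y; first exact: Cs.
  move: yC; rewrite !mem_filter => /and3P[_ -> _].
  by rewrite -/(pattern c y) py.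
apply: leq_trans (leq_add leU leC) _ => /=.
case: d {IH nch leU leC} => [|d]; first by rewrite !expn0.
rewrite !expnS -mulSnr; apply: leq_mul => //.
by case: d => [|d]; rewrite ?expn0// leq_exp2r.
Qed.

End Sauer.

(** * Finitely additive measures *)

Section Measure.
Variables (R : realType) (G : groupType) (F : set (set G)) (mu : set G -> R).
Hypotheses (algF : biinvariant_algebra F) (probmu : biinvariant_probability F mu).
Implicit Types (B C D E W : set G).
Local Open Scope ring_scope.

Lemma F_set0 : F set0. Proof. by case: algF. Qed.
Lemma F_setC B : F B -> F (~` B). Proof. by case: algF => _ _ + _ _; apply. Qed.
Lemma F_setU B C : F B -> F C -> F (B `|` C).
Proof. by case: algF => _ + _ _ _; apply. Qed.
Lemma F_setT : F setT. Proof. by rewrite -setC0; exact/F_setC/F_set0. Qed.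
Lemma F_setI B C : F B -> F C -> F (B `&` C).
Proof.
by move=> FB FC; rewrite -[B `&` C]setCK setCI; apply/F_setC/F_setU; exact: F_setC.
Qed.
Lemma F_setD B C : F B -> F C -> F (B `\` C).
Proof. by move=> FB FC; rewrite setDE; exact/F_setI/F_setC. Qed.
Lemma F_setY B C : F B -> F C -> F (B `+` C).
Proof. by move=> FB FC; apply: F_setU; exact: F_setD. Qed.

Lemma mu_ge0 B : F B -> 0 <= mu B. Proof. by case: probmu => + _ _ _ _; apply. Qed.
Lemma mu_setT : mu setT = 1. Proof. by case: probmu. Qed.
Lemma mu_split B C : F B -> F C -> mu B = mu (B `&` C) + mu (B `\` C).
Proof.
case: probmu => _ _ add _ _ FB FC; rewrite -add ?setUIDK//; first exact: F_setI.
  exact: F_setD.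
by rewrite setDE setIACA setICr setI0.
Qed.
Lemma mu_setU B C : F B -> F C -> B `&` C = set0 -> mu (B `|` C) = mu B + mu C.
Proof. by case: probmu => _ _ + _ _; apply. Qed.
Lemma mu_le B C : F B -> F C -> B `<=` C -> mu B <= mu C.
Proof.
move=> FB FC BC; rewrite (mu_split FC FB) setIidr// lerDl mu_ge0//.
exact: F_setD.
Qed.
Lemma mu_set0 : mu set0 = 0.
Proof.
by have /eqP := mu_split F_set0 F_set0; rewrite set0I set0D eq_sym addrC -subr_eq0 addrK => /eqP.
Qed.
Lemma mu_le1 B : F B -> mu B <= 1.
Proof. by move=> FB; rewrite -mu_setT; apply: mu_le => //; exact: F_setT. Qed.
Lemma mu_setU_le B C : F B -> F C -> mu (B `|` C) <= mu B + mu C.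
Proof.
move=> FB FC; rewrite (mu_split (F_setU FB FC) FB) lerD//.
  by apply: mu_le => //; exact/F_setI/FB/F_setU.
by apply: mu_le => //; [exact/F_setD/FB/F_setU|move=> x [[]]].
Qed.

Lemma rshiftE D (z : G) : [set x | D (x * z)%g] = rtrans D z^-1%g.
Proof.
apply/seteqP; split=> [x Dx|_ [y Dy <-]] /=; last by rewrite mulgVK.
by exists (x * z)%g => //; rewrite mulgK.
Qed.
Lemma lshiftE D (x : G) : [set z | D (x * z)%g] = ltrans x^-1%g D.
Proof.
apply/seteqP; split=> [z Dz|_ [y Dy <-]] /=; last by rewrite mulVKg.
by exists (x * z)%g => //; rewrite mulKg.
Qed.
Lemma F_rshift D z : F D -> F [set x | D (x * z)%g].
Proof. by rewrite rshiftE; case: algF => _ _ _ _; apply. Qed.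
Lemma F_lshift D x : F D -> F [set z | D (x * z)%g].
Proof. by rewrite lshiftE; case: algF => _ _ _ + _; apply. Qed.
Lemma mu_rshift D z : F D -> mu [set x | D (x * z)%g] = mu D.
Proof. by rewrite rshiftE; case: probmu => _ _ _ _; apply. Qed.
Lemma mu_lshift D x : F D -> mu [set z | D (x * z)%g] = mu D.
Proof. by rewrite lshiftE; case: probmu => _ _ _ + _; apply. Qed.

Lemma F_bigcup_seq (T : eqType) (s : seq T) (B : T -> set G) :
  (forall t, t \in s -> F (B t)) -> F [set x | exists2 t, t \in s & B t x].
Proof.
elim: s => [|t s IH] FB.
  rewrite (_ : [set x | _] = set0); first exact: F_set0.
  by apply/seteqP; split=> x // [].
have FtB : F (B t `|` [set x | exists2 t, t \in s & B t x]).
  by apply: F_setU; [|apply: IH => u us]; apply: FB; rewrite inE ?eqxx// us orbT.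
rewrite (_ : [set x | _] = B t `|` [set x | exists2 t, t \in s & B t x])//.
apply/seteqP; split=> x.
  by move=> [u]; rewrite inE => /orP[/eqP->|us]; [left|right; exists u].
by move=> [Btx|[u us]]; [exists t; rewrite ?mem_head|exists u; rewrite // inE us orbT].
Qed.

Lemma F_bigcap_seq (T : eqType) (s : seq T) (B : T -> set G) :
  (forall t, t \in s -> F (B t)) -> F [set x | forall t, t \in s -> B t x].
Proof.
move=> FB; have -> : [set x | forall t, t \in s -> B t x] =
    ~` [set x | exists2 t, t \in s & (~` B t) x].
  apply/seteqP; split=> x => [Bx [t /Bx]//|nB t ts].
  by apply: contrapT => Btx; apply: nB; exists t.
by apply/F_setC/F_bigcup_seq => t /FB; exact: F_setC.
Qed.

Lemma mu_bigcup_seq_le (T : eqType) (s : seq T) (B : T -> set G) (tau : R) :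
  (forall t, t \in s -> F (B t) /\ mu (B t) <= tau) ->
  mu [set x | exists2 t, t \in s & B t x] <= (size s)%:R * tau.
Proof.
elim: s => [|t s IH] FB.
  rewrite (_ : [set x | _] = set0) ?mu_set0 ?mul0r//.
  by apply/seteqP; split=> x // [].
have FBs u : u \in s -> F (B u) /\ mu (B u) <= tau.
  by move=> us; apply: FB; rewrite inE us orbT.
have [FBt Btau] := FB t (mem_head _ _).
rewrite (_ : [set x | _] = B t `|` [set x | exists2 t, t \in s & B t x]).
  apply: le_trans (mu_setU_le FBt _) _.
    by apply: F_bigcup_seq => u /FBs[].
  by rewrite /= -add1n natrD mulrDl mul1r lerD// IH.
apply/seteqP; split=> x.
  by move=> [u]; rewrite inE => /orP[/eqP->|us]; [left|right; exists u].
by move=> [Btx|[u us]]; [exists t; rewrite ?mem_head|exists u; rewrite // inE us orbT].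
Qed.

Lemma exists_avoiding (T : eqType) (s : seq T) (B : T -> set G) E (tau : R) :
  F E -> (forall t, t \in s -> F (B t) /\ mu (B t) <= tau) ->
  (size s)%:R * tau < mu E ->
  exists2 x, E x & forall t, t \in s -> ~ B t x.
Proof.
move=> FE FB lt; apply: contrapT => nex.
have /(lt_le_trans lt) : mu E <= mu [set x | exists2 t, t \in s & B t x].
  apply: mu_le => //; first by apply: F_bigcup_seq => t /FB[].
  move=> x Ex; apply: contrapT => nB; apply: nex; exists x => // t ts Bt.
  by apply: nB; exists t.
by rewrite ltNge mu_bigcup_seq_le.
Qed.

(** A finite form of the integral of a counting function, by cutting [W] along
    one of the sets: inside it the bound on the multiplicity drops by one. *)
Lemma sum_mu_le_multiplicity (T : eqType) (s : seq T) (B : T -> set G) W (c : nat) :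
  F W -> (forall t, t \in s -> F (B t)) ->
  (forall x, W x -> count (fun t => `[< B t x >]) s <= c)%N ->
  \sum_(t <- s) mu (W `&` B t) <= c%:R * mu W.
Proof.
elim: s W c => [|t s IH] W c FW FB cnt.
  by rewrite big_nil mulr_ge0// mu_ge0.
have FBs u : u \in s -> F (B u) by move=> us; apply: FB; rewrite inE us orbT.
have FBt := FB t (mem_head _ _).
have FI := F_setI FW FBt; have FD := F_setD FW FBt.
have sumE : \sum_(u <- s) mu (W `&` B u) =
    \sum_(u <- s) mu (W `&` B t `&` B u) + \sum_(u <- s) mu ((W `\` B t) `&` B u).
  rewrite -big_split/=; apply: eq_big_seq => u /FBs FBu.
  by rewrite (mu_split (F_setI FW FBu) FBt) !setDE ![W `&` B u `&` _]setIAC.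
rewrite big_cons sumE (mu_split FW FBt) mulrDr addrA lerD//; last first.
  by apply: IH => // x [Wx nBt]; have := cnt x Wx => /=; case: asboolP.
have [->|/set0P[x [Wx Btx]]] := eqVneq (W `&` B t) set0.
  by rewrite mu_set0 mulr0 add0r big1// => u _; rewrite set0I mu_set0.
case: c => [|c] in cnt *; first by have := cnt x Wx; rewrite /= asboolT.
rewrite -natr1 mulrDl mul1r [leRHS]addrC lerD// IH// => y [Wy Bty].
by have := cnt y Wy; rewrite /= asboolT.
Qed.

(** A point of largest multiplicity does at least as well as the average. *)
Lemma exists_multiplicity (T : eqType) (s : seq T) (B : T -> set G) W (delta : R) :
  F W -> (forall t, t \in s -> [/\ F (B t), B t `<=` W & delta <= mu (B t)]) ->
  exists x, (size s)%:R * delta <= (count (fun t => `[< B t x >]) s)%:R * mu W.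
Proof.
move=> FW FB; pose cnt x := count (fun t => `[< B t x >]) s.
have ex1 : exists i, `[< exists x, cnt x = i >].
  by exists (cnt 1%g); apply/asboolP; exists 1%g.
have le_size i : `[< exists x, cnt x = i >] -> (i <= size s)%N.
  by move=> /asboolP[x <-]; exact: count_size.
have [c /asboolP[x <-] cmax] := ex_maxnP ex1 le_size.
exists x; rewrite -/(cnt x).
apply: le_trans (@sum_mu_le_multiplicity _ s B W (cnt x) FW _ _); last 2 first.
- by move=> t /FB[].
- by move=> y _; apply: cmax; apply/asboolP; exists y.
rewrite -sum1_size natr_sum mulr_suml big_seq [leRHS]big_seq.
by apply: ler_sum => t /FB[_ BW dB]; rewrite mul1r setIidr.
Qed.

(** The measured form of [ladder_exists]: n sections of measure delta inside [W]
    overlap K times as soon as n delta reaches K mu(W), and n^K sets of measure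
    tau do not cover [E]. *)
Lemma measure_ladder (P : G -> G -> Prop) E W (K n : nat) (delta tau : R) :
  F E -> F W -> 0 < mu W ->
  (forall x, E x -> [/\ F [set z | P x z], [set z | P x z] `<=` W &
                        delta <= mu [set z | P x z]]) ->
  (forall z, F [set x | P x z] /\ mu (E `&` [set x | P x z]) <= tau) ->
  K%:R * mu W <= n%:R * delta -> (n ^ K)%:R * tau < mu E ->
  exists (a : 'I_K -> G) (c : 'I_K -> G), ladder P a c.
Proof.
move=> FE FW W0 PE Pz Kn Ltau.
have tau0 : 0 <= tau.
  by have [FP] := Pz 1%g; apply: le_trans; exact/mu_ge0/F_setI.
apply: (@ladder_exists _ _ P E K n) => [xs xsn xsE|zs zsn]; last first.
  have [||x Ex Px] := @exists_avoiding _ zs (fun z => E `&` [set x | P x z]) E tau FE.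
  - by move=> z _; have [FP mP] := Pz z; split=> //; exact: F_setI.
  - apply: le_lt_trans Ltau; rewrite ler_wpM2r// ler_nat//.
  by exists x => // z /Px nP Pxz; apply: nP.
have [|z] := @exists_multiplicity _ xs (fun x => [set z | P x z]) W delta FW.
  by move=> x /xsE/PE.
by rewrite xsn => /(le_trans Kn); rewrite ler_pM2r// ler_nat => Kz; exists z.
Qed.
(** * The drift of a group element *)
Variables (A : set G) (FA : F A).

Definition moved (g : G) : set G := [set x | A (x * g)%g /\ ~ A x].

Definition drift (g : G) : R := mu (moved g).

Lemma movedE g : moved g = [set x | A (x * g)%g] `\` A.
Proof. by apply/seteqP; split=> x []. Qed.

Lemma F_moved g : F (moved g).
Proof. by rewrite movedE; apply: F_setD => //; exact: F_rshift. Qed.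

Lemma drift_ge0 g : 0 <= drift g. Proof. exact/mu_ge0/F_moved. Qed.

Lemma drift_le1 g : drift g <= 1. Proof. exact/mu_le1/F_moved. Qed.

Lemma gapE g h : [set x | gap A x (g, h)] = [set x | moved (h^-1 * g)%g (x * h)%g].
Proof. by apply/seteqP; split=> x; rewrite /gap /moved /= mulgA mulgK. Qed.

Lemma F_gap g h : F [set x | gap A x (g, h)].
Proof. by rewrite gapE; exact/F_rshift/F_moved. Qed.

Lemma mu_gap g h : mu [set x | gap A x (g, h)] = drift (h^-1 * g)%g.
Proof. by rewrite gapE mu_rshift//; exact: F_moved. Qed.

(** The two halves of the symmetric difference of A and a translate of A have
    equal measure, because A and its translate do. *)
Lemma driftV g : drift g^-1%g = drift g.
Proof.
have Fg := F_rshift g FA.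
have e : mu [set x | A (x * g)%g] = mu A by rewrite mu_rshift.
have -> : drift g^-1%g = mu (A `\` [set x | A (x * g)%g]).
  rewrite -[g^-1%g]mulg1 -mu_gap; congr mu; apply/seteqP.
  by split=> x; rewrite /gap /= mulg1.
move: e; rewrite (mu_split Fg FA) (mu_split FA Fg) setIC.
by move/addrI; rewrite /drift movedE => ->.
Qed.

Lemma driftM g h : drift (g * h)%g <= drift g + drift h.
Proof.
have -> : drift h = mu [set x | gap A x ((g * h)%g, g)] by rewrite mu_gap mulKg.
apply: (le_trans _ (mu_setU_le (F_moved g) (F_gap (g * h)%g g))).
apply: mu_le => //; [exact: F_moved|by apply: F_setU => //; [exact: F_moved|exact: F_gap]|].
move=> x [Axgh nAx]; case: (pselect (A (x * g)%g)) => [Axg|nAxg]; first by left.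
by right; split.
Qed.

Lemma drift1 : drift 1%g = 0.
Proof.
by rewrite /drift movedE (_ : _ `\` _ = set0) ?(mu_set0)//;
   apply/seteqP; split=> x //=; rewrite mulg1 => -[].
Qed.

Lemma mu_rtrans_setY g : mu (rtrans A g `+` A) = 2 * drift g.
Proof.
have e : rtrans A g = [set x | A (x * g^-1)%g] by rewrite rshiftE invgK.
have FAg : F (rtrans A g) by rewrite e; exact: F_rshift.
rewrite (mu_setU); [|exact: F_setD|exact: F_setD|]; last first.
  by apply/seteqP; split=> x // -[[? ?] []].
have -> : mu (rtrans A g `\` A) = drift g by rewrite -driftV e -movedE.
have -> : mu (A `\` rtrans A g) = drift g.
  rewrite -[in RHS](invgK g) -[in RHS](mulg1 g^-1^-1%g) -mu_gap e; congr mu.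
  by apply/seteqP; split=> x; rewrite /gap /= mulg1.
by rewrite mulr_natl mulr2n.
Qed.

Lemma StabE m g : Stab mu m A g <-> drift g <= 2 ^- m.+1.
Proof.
rewrite /Stab /= mu_rtrans_setY exprS invfM.
by rewrite ler_pdivlMl.
Qed.

(** * Decay of drifts *)

Section Ladderless.
Variables (K : nat) (K_gt0 : (0 < K)%N).
Hypothesis no_ladder : forall (a : 'I_K -> G) (c : 'I_K -> G * G), ~ ladder (gap A) a c.

(** On average over z the overlap should be mu(E) drift(h); a power of the drift
    is enough here.  If no z is good, then every z is related to a small part
    of [E], while every x in [E] is related to a set of z of measure [drift h],
    and [measure_ladder] gives a half graph. *)
Lemma moved_meets E h : F E -> 0 < mu E -> 0 < drift h ->
  exists z, mu E * (drift h / (K.+2)%:R) ^+ K <=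
            mu (E `&` [set x | moved h (x * z)%g]).
Proof.
move=> FE E0 h0; apply: contrapT => nz.
set tau := mu E * _ in nz.
have small z : mu (E `&` [set x | moved h (x * z)%g]) <= tau.
  by rewrite leNgt; apply/negP => /ltW ltz; apply: nz; exists z.
(* K + 2 in place of K + 1 makes (n drift h / (K + 2)) ^ K < 1 strict. *)
pose n := (Num.truncn (K%:R / drift h)).+1.
have [|||||||a [c lad]] :=
  @measure_ladder (fun x z => moved h (x * z)%g) E setT K n (drift h) tau.
- by [].
- exact: F_setT.
- by rewrite (mu_setT).
- by move=> x _; split=> //; [exact/F_lshift/F_moved|rewrite mu_lshift//; exact: F_moved].
- by move=> z; split=> //; exact/F_rshift/F_moved.
- rewrite (mu_setT) mulr1 -ler_pdivrMr// ltW//.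
  exact: truncnS_gt.
- rewrite /tau mulrCA gtr_pMr// natrX -exprMn_comm; last exact: mulrC.
  rewrite exprn_ilt1 -?lt0n//; first by rewrite mulr_ge0// divr_ge0// ltW.
  rewrite mulrA ltr_pdivrMr ?ltr0n// mul1r.
  have : (Num.truncn (K%:R / drift h))%:R <= K%:R / drift h.
    by rewrite truncn_le divr_ge0// ltW.
  rewrite ler_pdivlMr// -[n%:R]natr1 mulrDl mul1r => le1.
  by apply: le_lt_trans (lerD le1 (drift_le1 h)) _; rewrite natr1 ltr_nat.
apply: (no_ladder (a := a) (c := fun j => (c j * h, c j)%g)) => i j.
by rewrite -lad /gap /moved /= mulgA.
Qed.

(** The intersection of the first i + 1 translates keeps measure at least
    K drift(h_{i+1}), which exceeds the total measure of the at most K - 1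
    later ones.  The choice of the next translate costs the factor of
    [moved_meets], and the hypothesis on the decay is exactly what restores the
    lower bound at the next index. *)
Lemma no_fast_decay (h : nat -> G) :
  (forall i, (i < K)%N -> 0 < drift (h i)) ->
  (forall i, (i.+1 < K)%N ->
     (K.+2)%:R ^+ K * drift (h i.+1) <= drift (h i) ^+ K.+1) -> False.
Proof.
move=> h_gt0 decay.
have decay0 i : (i.+1 < K)%N -> K%:R * drift (h i.+1) <= drift (h i).
  move=> iK; apply: (@le_trans _ _ (K.+2%:R ^+ K * drift (h i.+1))).
    rewrite ler_wpM2r ?drift_ge0// -natrX ler_nat.
    exact/ltnW/ltn_expl.
  apply: le_trans (decay i iK) _.
  by rewrite exprS ler_piMr ?drift_ge0// exprn_ile1 ?drift_ge0 ?drift_le1.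
have noninc i : (i.+1 < K)%N -> drift (h i.+1) <= drift (h i).
  by move=> iK; apply: le_trans (decay0 i iK); rewrite ler_peMl ?drift_ge0 ?ler1n.
pose E (zs : seq G) i := [set x | forall j, (j <= i)%N -> moved (h j) (x * nth 1%g zs j)%g].
pose good zs i := 0 < mu (E zs i) /\
   ((i.+1 < K)%N -> K%:R * drift (h i.+1) <= mu (E zs i)).
have FE zs i : F (E zs i).
  rewrite (_ : E zs i = [set x | forall j, j \in iota 0 i.+1 ->
      [set x | moved (h j) (x * nth 1%g zs j)%g] x]).
    by apply: F_bigcap_seq => // j _; exact/F_rshift/F_moved.
  by apply/seteqP; split=> x Ex j; have := Ex j; rewrite mem_iota.
have ES zs i : E zs i.+1 = E zs i `&` [set x | moved (h i.+1) (x * nth 1%g zs i.+1)%g].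
  apply/seteqP; split=> [x Ex|x [Ex Exi] j].
    by split=> [j ji|]; apply: Ex => //; exact: leqW.
  by rewrite leq_eqVlt => /orP[/eqP->//|]; exact: Ex.
have E_rcons zs z i : (i < size zs)%N -> E (rcons zs z) i = E zs i.
  move=> ilt; apply/seteqP; split=> x Ex j ji; have := Ex j ji;
  by rewrite nth_rcons (leq_ltn_trans ji ilt).
have [zs zsK goodzs] : exists2 zs, size zs = K & forall i, (i < K)%N -> good zs i.
  have: (K <= K)%N by [].
  elim: {-2}K => [|n IH] nK; first by exists [::].
  have {IH} [zs zsn gzs] := IH (ltnW nK).
  suff [z gz] : exists z, good (rcons zs z) n.
    exists (rcons zs z); first by rewrite size_rcons zsn.
    move=> i; rewrite ltnS leq_eqVlt => /orP[/eqP->//|ilt].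
    by rewrite /good E_rcons ?zsn//; exact: gzs.
  case: n => [|n] in nK zsn gzs *.
    exists 1%g; have {zsn zs gzs}-> : zs = [::] by case: (zs) zsn.
    have -> : good (rcons [::] 1%g) 0%N = (0 < drift (h 0%N) /\
        ((1 < K)%N -> K%:R * drift (h 1%N) <= drift (h 0%N))).
      rewrite /good; suff -> : E (rcons [::] 1%g) 0%N = moved (h 0%N) by [].
      apply/seteqP; split=> x; first by move=> /(_ 0%N isT) /=; rewrite mulg1.
      by move=> mx j; rewrite leqn0 => /eqP-> /=; rewrite mulg1.
    split; first exact: h_gt0.
    exact: decay0.
  have [z mz] := moved_meets (FE zs n) (gzs n (ltnSn n)).1 (h_gt0 _ nK).
  exists z; have hn0 := h_gt0 _ nK.
  have En : E (rcons zs z) n.+1 = E zs n `&` [set x | moved (h n.+1) (x * z)%g].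
    by rewrite ES E_rcons ?zsn// nth_rcons zsn ltnn eqxx.
  rewrite /good En; split.
    apply: lt_le_trans mz; rewrite mulr_gt0 ?exprn_gt0 ?divr_gt0//.
    exact: (gzs n (ltnSn n)).1.
  move=> n2K; apply: le_trans mz.
  apply: (@le_trans _ _ (K%:R * drift (h n.+1) * (drift (h n.+1) / K.+2%:R) ^+ K)); last first.
    apply: ler_wpM2r; last exact: (gzs n (ltnSn n)).2.
    by rewrite exprn_ge0// divr_ge0// ltW.
  rewrite -mulrA ler_wpM2l// expr_div_n mulrA -exprS ler_pdivlMr ?exprn_gt0//.
  by rewrite mulrC; exact: decay.
have noninc_le i j : (i <= j)%N -> (j < K)%N -> drift (h j) <= drift (h i).
  elim: j => [|j IH]; first by rewrite leqn0 => /eqP->.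
  rewrite leq_eqVlt => /orP[/eqP->//|ij] jK.
  by apply: le_trans (noninc j jK) _; apply: IH => //; exact: ltnW.
have pick (i : 'I_K) : exists x, forall j : 'I_K,
    moved (h j) (x * nth 1%g zs j)%g <-> (j <= i)%N.
  have [g0 gK] := goodzs i (ltn_ord i).
  pose s := iota i.+1 (K - i.+1).
  pose B j := [set x | moved (h j) (x * nth 1%g zs j)%g].
  have [||x Ex nx] := @exists_avoiding _ s B _ (drift (h i.+1)) (FE zs i).
  - move=> j; rewrite mem_iota => /andP[ij jK].
    have {}jK : (j < K)%N by move: jK; rewrite subnKC.
    rewrite /B mu_rshift//; last exact: F_moved.
    by split; [exact/F_rshift/F_moved|exact: noninc_le].
  - rewrite size_iota; have [iK|] := ltnP i.+1 K; last first.
      by rewrite -subn_eq0 => /eqP->; rewrite mul0r.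
    apply: lt_le_trans (gK iK); rewrite ltr_pM2r ?h_gt0// ltr_nat.
    by rewrite ltn_subrL K_gt0.
  exists x => j; split=> [mj|]; last exact: Ex.
  rewrite leqNgt; apply/negP => ij; apply: (nx j) mj.
  by rewrite mem_iota ij subnKC//=.
have [a aP] := choice pick.
apply: (no_ladder (a := a) (c := fun j => (nth 1 zs j * h j, nth 1 zs j)%g)) => i j.
by rewrite -aP /gap /moved /= mulgA.
Qed.

End Ladderless.

(** * Stabilization of the approximate stabilizers *)
Section Metastability.
Variables (k : nat) (k_gt1 : (1 < k)%N) (stA : kstable k A).
Let K := ramsey k k.+1.
Let S := ramsey K K.

Let K_gt2 : (2 < K)%N. Proof. exact: leq_ltn_trans (ramsey_gt k_gt1). Qed.
Let S_gt : ((K - 1) ^ 2 < S)%N.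
Proof. exact/ramsey_gt_sqr/ltnW. Qed.

(** The step n + 5 + 2 max e + log S makes the drift d_{i+1} at most
    d_i^2 / (32 S), that is, q_{i+1} <= q_i^2 for q_i = d_i / (32 S).  Over
    K - 1 steps the exponent becomes 2^(K-1) >= K + 1, which is the decay
    excluded by [no_fast_decay]. *)
Lemma metastable_Stab (e : nat -> nat) : exists2 m, (m <= Phi k e)%N &
  forall g, Stab mu m A g -> Stab mu (e m) A g.
Proof.
apply: contrapT => noM.
have /choice[g gP] : forall m, exists g, (m <= Phi k e)%N ->
    drift g <= 2 ^- m.+1 /\ 2 ^- (e m).+1 < drift g.
  move=> m; case: (leqP m (Phi k e)) => [mPhi|_]; last by exists 1%g.
  apply: contrapT => ng; apply: noM; exists m => // g /StabE gm.
  apply/StabE; rewrite leNgt; apply/negP => eg; apply: ng.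
  by exists g => _; split.
pose n i := iter i (ftilde k e) 0%N.
have nS i : n i.+1 = (n i + 5 + 2 * fmax e (n i).+1 + up_log 2 S)%N.
  by rewrite /n iterS {1}/ftilde /ramsey_s subn1.
have n_le i j : (i <= j)%N -> (n i <= n j)%N.
  elim: j => [|j IH]; first by rewrite leqn0 => /eqP->.
  rewrite leq_eqVlt => /orP[/eqP->//|/IH le]; apply: leq_trans le _.
  by rewrite nS; lia.
(* The scale n_i + 1 is covered by the maximum of e in the step from n_i. *)
pose d i := drift (g (n i).+1).
have dP i : (i <= S)%N -> d i <= 2 ^- (n i).+2 /\ 2 ^- (e (n i).+1).+1 < d i.
  move=> iS; apply: gP; apply: leq_trans (_ : n i.+1 <= _)%N.
    by rewrite nS; lia.
  by apply: (n_le i.+1 (ramsey_s k)); rewrite /ramsey_s ltnS.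
pose c : R := (32 * S)%:R.
have c_gt0 : 0 < c by rewrite /c ltr0n; lia.
have sq i : (i < S)%N -> c * d i.+1 <= d i ^+ 2.
  move=> iS; have [d1 _] := dP i.+1 iS; have [_ d0] := dP i (ltnW iS).
  have eM : (e (n i).+1 <= fmax e (n i).+1)%N.
    exact: (leq_bigmax (F := fun j : 'I_(n i).+2 => e j) ord_max).
  have cS : c <= 2 ^+ (5 + up_log 2 S).
    by rewrite /c -natrX ler_nat expnD leq_mul// up_logP.
  apply: (@le_trans _ _ ((2 ^- (e (n i).+1).+1) ^+ 2)); last first.
    by rewrite ler_sqr ?nnegrE ?drift_ge0// ltW.
  apply: le_trans (ler_pM (ltW c_gt0) (drift_ge0 _) cS d1) _.
  rewrite exprVn -exprM ler_pdivrMr ?exprn_gt0// mulrC ler_pdivlMr ?exprn_gt0//.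
  by rewrite -exprD ler_eXn2l ?ltr1n// nS; lia.
pose q i := d i / c.
have q0 i : 0 <= q i by rewrite divr_ge0 ?drift_ge0// ltW.
have q1 i : q i <= 1.
  rewrite ler_pdivrMr// mul1r; apply: le_trans (drift_le1 _) _.
  by rewrite /c ler1n; lia.
have qS i : (i < S)%N -> q i.+1 <= q i ^+ 2.
  move=> /sq; rewrite /q expr_div_n expr2 [c ^+ 2]expr2 invfM mulrA ler_pM2r ?invr_gt0//.
  by rewrite ler_pdivlMr// mulrC.
have qD i t : (i + t <= S)%N -> q (i + t)%N <= q i ^+ (2 ^ t).
  elim: t => [|t IH]; first by rewrite addn0 expr1.
  rewrite addnS => it; apply: le_trans (qS _ it) _.
  rewrite expnSr exprM ler_sqr ?nnegrE ?exprn_ge0//.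
  by apply: IH; exact: ltnW.
have iKS i : (i < K)%N -> (i * (K - 1) <= S)%N.
  move=> iK; apply: leq_trans (ltnW S_gt); rewrite leq_mul2r; apply/orP; right.
  by lia.
apply: (@no_fast_decay K _ _ (fun i => g (n (i * (K - 1))%N).+1)) => [|a b lad|i iK|i iK].
- by lia.
- exact: kstable_gap lad.
- have [_] := dP _ (iKS i iK); apply: le_lt_trans.
  by rewrite invr_ge0 exprn_ge0.
rewrite -!/(d _).
have dq j : d j = c * q j by rewrite mulrC divfK// gt_eqF.
rewrite (dq (i.+1 * _)%N).
have qq : q (i.+1 * (K - 1))%N <= q (i * (K - 1))%N ^+ K.+1.
  rewrite mulSn addnC; apply: le_trans (qD _ _ _) _.
    by rewrite addnC -mulSn iKS.
  apply: ler_wiXn2l => //.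
  have -> : K = (K - 3).+3 by lia.
  by rewrite subSS subn0 !expnS; have := ltn_expl (K - 3) (isT : 1 < 2)%N; lia.
apply: (@le_trans _ _ (c ^+ K * (c * q (i * (K - 1))%N ^+ K.+1))); last first.
  by rewrite mulrA -exprSr -exprMn_comm -?dq//; exact: mulrC.
apply: ler_pM; rewrite ?exprn_ge0 ?mulr_ge0 ?invr_ge0 ?drift_ge0 ?(ltW c_gt0)//.
  rewrite lerXn2r ?nnegrE ?ler0n ?(ltW c_gt0)// /c ler_nat.
  have : (K - 1 <= (K - 1) ^ 2)%N by rewrite -[X in (X <= _)%N]expn1 leq_exp2l; lia.
  by lia.
by rewrite ler_wpM2l// ltW.
Qed.

End Metastability.

(** * The stabilizer belongs to the algebra *)
Section Nets.
Variable K : nat.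
Hypothesis no_ladder : forall (a : 'I_K -> G) (c : 'I_K -> G * G), ~ ladder (gap A) a c.

(** Without a finite net, any finite set of points is avoided by a difference of
    measure above [eps], and [ladder_exists] applies with the pairs (g, h) as
    the points to be chosen. *)
Lemma finite_net (eps : R) : 0 < eps -> exists zs : seq G, forall g h,
  (forall z, z \in zs -> ~ gap A z (g, h)) -> drift (h^-1 * g)%g <= eps.
Proof.
move=> eps0; apply: contrapT => nonet.
pose far (q : G * G) := eps < drift (q.2^-1 * q.1)%g.
pose n := (Num.truncn (K%:R / eps)).+1.
have [||a [c lad]] := @ladder_exists _ _ (fun q z => gap A z q) far K n.
- move=> s sn sfar.
  have [|z] := @exists_multiplicity _ s (fun q => [set z | gap A z q]) setT eps F_setT.
    move=> [g h] /sfar/ltW gh; split=> //; first exact: F_gap.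
    by rewrite mu_gap.
  rewrite mu_setT mulr1 sn => le; exists z; rewrite -(ler_nat R).
  apply: le_trans le; rewrite -ler_pdivrMr// ltW//; exact: truncnS_gt.
- move=> zs _; apply: contrapT => nq; apply: nonet; exists zs => g h nz.
  rewrite leNgt; apply/negP => gh; apply: nq; exists (g, h) => //.
- exact: (no_ladder (ladder_rev lad)).
Qed.

(** The set of h for which z h is in A whenever z is in the net and z g is in A
    contains g, lies in the coset of g, and depends only on a subset of the
    net.  Finitely many such sets exhaust the stabilizer. *)
Lemma F_Stab m : is_subgroup (Stab mu m A) -> F (Stab mu m A).
Proof.
set H := Stab mu m A => -[_ Hdiv].
have divH x y : H x -> H y -> H (x / y)%g.
  by move=> Hx Hy; have := Hdiv x y; rewrite !inE; apply.
have eps0 : (0 : R) < 2 ^- m.+1 by rewrite invr_gt0 exprn_gt0.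
have [zs net] := finite_net eps0.
pose V (l : seq G) := [set h | forall z, z \in l -> [set h | A (z * h)%g] h].
pose masks := [seq t : (size zs).-tuple bool <- enum {: (size zs).-tuple bool} | `[< V (mask t zs) `<=` H >]].
have -> : H = [set h | exists2 t : (size zs).-tuple bool, t \in masks & V (mask t zs) h].
  apply/seteqP; split=> [g Hg|g [t]]; last first.
    by rewrite mem_filter => /andP[/asboolP + _]; apply.
  exists [tuple of map (fun z => `[< A (z * g)%g >]) (in_tuple zs)] => /=.
    rewrite mem_filter mem_enum andbT; apply/asboolP => h /=.
    rewrite -filter_mask => Vh.
    have Hhg : H (h^-1 * g)%g.
      apply/StabE/net => z zzs [/= Azg]; apply; apply: Vh.
      by rewrite mem_filter zzs asboolT.
    by have := divH _ _ Hg Hhg; rewrite invgM invgK mulgA mulgV mul1g.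
  by move=> z; rewrite -filter_mask mem_filter => /andP[/asboolP].
apply: F_bigcup_seq => t _; apply: F_bigcap_seq => z _; exact: F_lshift.
Qed.

End Nets.

(** * The index of the stabilizer *)

Section Packing.

(** Each new point can be chosen to lie in a fraction [eps] of the sets not hit
    so far. *)
Lemma exists_hitting_seq (T : eqType) (s : seq T) (B : T -> set G) (eps : R) n :
  eps <= 1 -> (forall t, t \in s -> F (B t) /\ eps <= mu (B t)) ->
  exists2 xs, size xs = n &
    (count (fun t => all (fun x => ~~ `[< B t x >]) xs) s)%:R
      <= (1 - eps) ^+ n * (size s)%:R.
Proof.
move=> eps1 FB; elim: n => [|n [xs xsn IH]].
  by exists [::] => //=; rewrite expr0 mul1r ler_nat count_size.
pose s' := [seq t <- s | all (fun x => ~~ `[< B t x >]) xs].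
have [|x] := @exists_multiplicity _ s' B setT eps F_setT.
  by move=> t; rewrite mem_filter => /andP[_ /FB[]].
rewrite mu_setT mulr1 => hit; exists (x :: xs); first by rewrite /= xsn.
rewrite exprS -mulrA; apply: le_trans (_ : (1 - eps) * (size s')%:R <= _); last first.
  by rewrite size_filter ler_wpM2l// subr_ge0.
have -> : count (fun t => all (fun y => ~~ `[< B t y >]) (x :: xs)) s =
    count (fun t => ~~ `[< B t x >]) s'.
  by rewrite count_filter; apply: eq_count => t.
have -> : count (fun t => ~~ `[< B t x >]) s' =
    (size s' - count (fun t => `[< B t x >]) s')%N.
  by rewrite -(count_predC (fun t => `[< B t x >]) s') addKn.
by rewrite natrB ?count_size// mulrBl mul1r lerB// mulrC.
Qed.

Lemma one_minus_expn M : (1 - 2 ^- M : R) ^+ (2 ^ M) <= 2^-1.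
Proof.
set eps : R := 2 ^- M.
have eps0 : 0 <= eps by rewrite invr_ge0 exprn_ge0.
have eps1 : eps <= 1 by rewrite invf_le1 ?exprn_gt0// exprn_ege1// ler1n.
(* Bernoulli's inequality, used for the inverse factor 1 + eps. *)
have bern n : 1 + n%:R * eps <= (1 + eps) ^+ n.
  elim: n => [|n IH]; first by rewrite mul0r addr0 expr0.
  rewrite exprS; apply: le_trans (_ : (1 + eps) * (1 + n%:R * eps) <= _); last first.
    by rewrite ler_wpM2l// addr_ge0.
  rewrite -natr1; have : 0 <= n%:R * eps * eps by rewrite !mulr_ge0.
  by lra.
have : (1 - eps) ^+ (2 ^ M) * (1 + eps) ^+ (2 ^ M) <= 1.
  rewrite -exprMn_comm; last exact: mulrC.
  rewrite exprn_ile1//; first by rewrite mulr_ge0 ?subr_ge0 ?addr_ge0.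
  by have := sqr_ge0 eps; rewrite expr2; lra.
have := bern (2 ^ M)%N; rewrite natrX /eps divff ?expf_neq0// -/eps => two prod1.
rewrite -[leRHS]mul1r ler_pdivlMr//; apply: le_trans prod1.
rewrite ler_wpM2l//; first by rewrite exprn_ge0 ?subr_ge0.
Qed.

(** The at most 2^(2 L) differences between separated elements have measure above
    2^-(m+1), so 2^(m+1) (2 L + 1) points suffice to hit all of them.  On these
    points the 2^L elements have distinct traces, and a chain of length k among
    the traces would be a half graph. *)
Lemma packing k m L (ys : seq G) : (0 < k)%N -> kstable k A ->
  uniq ys -> size ys = (2 ^ L)%N ->
  {in ys &, forall y y', y != y' -> ~ Stab mu m A (y^-1 * y')%g} ->
  (2 ^ L <= (2 ^ m.+1 * (2 * L).+1).+1 ^ (k - 1))%N.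
Proof.
move=> k0 stA uys ysL sep.
pose pairs := [seq q <- [seq (y, y') | y <- ys, y' <- ys] | q.1 != q.2].
have sz : (size pairs <= 2 ^ (2 * L))%N.
  rewrite size_filter; apply: leq_trans (count_size _ _) _.
  by rewrite size_allpairs ysL mul2n -addnn expnD.
have eps1 : (2 : R) ^- m.+1 <= 1.
  by rewrite invf_le1 ?exprn_gt0// exprn_ege1// ler1n.
have [|xs xsn hit] := @exists_hitting_seq _ pairs (fun q => [set x | gap A x q])
  (2 ^- m.+1) (2 ^ m.+1 * (2 * L).+1) eps1.
  move=> [y y'] /=; rewrite mem_filter => /andP[/= yy' /allpairsP[[u v] [/= uys' vys [yu y'v]]]].
  split; first exact: F_gap.
  rewrite mu_gap; apply: ltW; rewrite ltNge; apply/negP => /StabE.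
  by subst; apply: sep => //; rewrite eq_sym.
have all_hit : all (fun q => has (fun x => `[< gap A x q >]) xs) pairs.
  have : (count (fun t => all (fun x => ~~ `[< [set x | gap A x t] x >]) xs) pairs < 1)%N.
    rewrite -(ltr_nat R); apply: le_lt_trans hit _.
    apply: le_lt_trans (_ : 2^-1 ^+ (2 * L).+1 * 2 ^+ (2 * L) < _).
      apply: ler_pM => //; first by rewrite exprn_ge0// subr_ge0.
        rewrite exprM lerXn2r ?nnegrE ?exprn_ge0 ?subr_ge0// ?one_minus_expn//.
      by rewrite -natrX ler_nat.
    rewrite exprVn exprS invfM -mulrA mulVf ?mulr1 ?expf_neq0//.
    by lra.
  rewrite ltnS leqn0 -/(_ == _) -leqn0 leqNgt -has_count => /hasPn nh.
  by apply/allP => q /nh; rewrite -has_predC => /hasP[x xxs /=]; rewrite negbK => ?; apply/hasP; exists x.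
rewrite -ysL -xsn subn1.
have := @size_patterns _ _ (fun x y => `[< A (x * y)%g >]) k xs ys.
case: k k0 stA => // k _ stA; apply.
  rewrite map_inj_in_uniq// => y y' yys y'ys /eq_in_map e; apply/eqP; apply: contraT => yy'.
  have /(allP all_hit)/hasP[x xxs /asboolP[/= Ay nAy]] : (y, y') \in pairs.
    by rewrite mem_filter /= yy'; apply/allpairsP; exists (y, y').
  by have /(congr1 is_true) := e x xxs; rewrite !asboolE => Axy; case: nAy; rewrite -Axy.
move=> [c [cS _ cP]]; apply: stA.
have ex (j : 'I_k.+1) : exists y, pattern (fun x y => `[< A (x * y)%g >]) c y =
    nseq j.+1 true ++ nseq (k.+1 - j.+1) false.
  by have [y _ py] := cP j.+1 (ltn_ord j); exists y.
have [y yP] := choice ex.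
exists (fun i => nth 1%g c i), y => i j.
have := congr1 (fun l => nth false l i) (yP j).
rewrite (nth_map 1%g) ?cS// nth_cat size_nseq !nth_nseq ltnS.
case: (leqP i j) => ij; last by rewrite if_same => /asboolP.
by move/asboolP.
Qed.

End Packing.

(** * Cosets of the stabilizer and approximation *)
Section Cosets.
Variables (k m : nat) (stA : kstable k A).
Hypothesis subH : is_subgroup (Stab mu m A).
Let H := Stab mu m A.
Variable tau : R.
Hypothesis drift_le : forall h, H h -> drift h <= tau.

Let H1 : H 1%g. Proof. by case: subH => + _; rewrite inE. Qed.
Let HV x : H x -> H x^-1%g.
Proof. by move=> Hx; have /(_ x) := group_closedV subH; rewrite !inE; apply. Qed.
Let HM x y : H x -> H y -> H (x * y)%g.
Proof. by move=> Hx Hy; have /(_ x y) := group_closedM subH; rewrite !inE; apply. Qed.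

Definition lcoset_at (y : G) : set G := [set x | H (y^-1 * x)%g].

Lemma ltrans_Stab y : ltrans y H = lcoset_at y.
Proof. by rewrite /lcoset_at lshiftE invgK. Qed.

Hypotheses (FH : F H) (H_gt0 : 0 < mu H).

Lemma F_lcoset y : F (lcoset_at y). Proof. exact: F_lshift. Qed.

(** For x in the coset outside [B], at least half of the h in H send x into [B],
    whereas each h does so for a set of x of measure at most [tau].  Because
    the large sections have relative measure 1/2, about 2 k points are enough,
    and the loss is a factor depending on k only. *)
Lemma minority_in_coset (B : set G) y : F B ->
  (forall a c : 'I_k.+1 -> G, ~ ladder (fun x z => B (x * z)%g) a c) ->
  (forall h, H h -> mu ([set x | B (x * h)%g] `\` B) <= tau) ->
  mu H / 2 <= mu (lcoset_at y `&` B) ->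
  mu (lcoset_at y `\` B) <= ((2 * k.+1) ^ k.+1)%:R * tau.
Proof.
move=> FB noB Btau maj; rewrite leNgt; apply/negP => big.
have FC := F_lcoset y.
have tau_ge0 : 0 <= tau by apply: le_trans (drift_le H1); exact: drift_ge0.
have [|||||||a [c lad]] := @measure_ladder (fun x z => H z /\ B (x * z)%g)
  (lcoset_at y `\` B) H k.+1 (2 * k.+1) (mu H / 2) tau.
- exact: F_setD.
- exact: FH.
- exact: H_gt0.
- move=> x [Cx _].
  have e : [set z | H z /\ B (x * z)%g] = [set z | (lcoset_at y `&` B) (x * z)%g].
    apply/seteqP; split=> z [Hz Bz]; split=> //.
      by rewrite /lcoset_at /= mulgA; exact: HM.
    by move: (HM (HV Cx) Hz); rewrite invgM invgK !mulgA mulgK mulVg mul1g.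
  rewrite e; split=> [||]; first exact/F_lshift/F_setI.
    by rewrite -e => z [].
  by rewrite mu_lshift//; exact: F_setI.
- move=> z; have [Hz|nHz] := pselect (H z).
    have -> : [set x | H z /\ B (x * z)%g] = [set x | B (x * z)%g].
      by apply/seteqP; split=> x // -[].
    have FBz := F_rshift z FB; split=> //; apply: le_trans (Btau z Hz).
    apply: mu_le; [exact/F_setI/FBz/F_setD|exact: F_setD|].
    by move=> x [[_ nBx] Bxz]; split.
  have -> : [set x | H z /\ B (x * z)%g] = set0 by apply/seteqP; split=> x // -[].
  by rewrite setI0 mu_set0; split=> //; exact: F_set0.
- by rewrite natrM; lra.
- exact: big.
apply: (noB a c) => i j; rewrite -lad; split=> [Bij|[]//]; split=> //.
by have [] := (lad j j).2 (leqnn j).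
Qed.

Lemma no_ladder_in (a c : 'I_k.+1 -> G) : ~ ladder (fun x z => A (x * z)%g) a c.
Proof.
move=> lad; apply: stA.
exists (fun i => a (widen_ord (leqnSn k) (rev_ord i))),
       (fun j => c (widen_ord (leqnSn k) (rev_ord j))) => i j.
by rewrite lad /=; have := ltn_ord i; have := ltn_ord j; split; lia.
Qed.

(** A half graph for the complement is one for A after a shift by one index,
    which is why size k + 1 is needed. *)
Lemma no_ladder_notin (a c : 'I_k.+1 -> G) : ~ ladder (fun x z => (~` A) (x * z)%g) a c.
Proof.
move=> lad; apply: stA.
exists (fun i => a (widen_ord (leqnSn k) i)), (fun j => c (lift ord0 j)) => i j.
have := lad (widen_ord (leqnSn k) i) (lift ord0 j).
rewrite /= leqNgt /bump leq0n add1n ltnS => -[le1 le2]; split=> [Aij|ij].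
  by apply: contraT => /le2.
by apply: contrapT => /le1; rewrite ij.
Qed.

(** Y consists of the cosets in which A has at least half of the measure; in
    each coset the error is the minority side. *)
Lemma Stab_approximation (rs : seq G) :
  (forall g, exists2 y, y \in rs & H (y^-1 * g)%g) ->
  exists2 Y, union_of_lcosets H Y &
    mu (A `+` Y) <= (size rs * (2 * k.+1) ^ k.+1)%:R * tau.
Proof.
move=> cover.
pose maj y := mu H / 2 <= mu (lcoset_at y `&` A).
pose rsA := [seq y <- rs | maj y].
pose Y := [set x | exists2 y, y \in rsA & lcoset_at y x].
exists Y.
  exists [set C | exists2 y, y \in rsA & C = ltrans y H].
    by move=> C [y _ ->]; exists y.
  apply/seteqP; split=> [x [y yrs yx]|x [C [y yrs ->]]].
    by exists (ltrans y H); [exists y|rewrite ltrans_Stab].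
  by rewrite ltrans_Stab => yx; exists y.
pose err y := if maj y then lcoset_at y `\` A else lcoset_at y `&` A.
have Ferr y : F (err y).
  by rewrite /err; case: ifP => _; [apply: F_setD|apply: F_setI] => //; exact: F_lcoset.
have FY : F Y by apply: F_bigcup_seq => y _; exact: F_lcoset.
have FAY := F_setY FA FY.
apply: (@le_trans _ _ (mu [set x | exists2 y, y \in rs & err y x])).
  apply: mu_le => //; first exact: F_bigcup_seq.
  move=> x [[Ax nYx]|[[y yrsA yx] nAx]].
    have [y yrs yx] := cover x; exists y => //; rewrite /err.
    case: ifP => // My; exfalso; apply: nYx; exists y => //.
    by rewrite mem_filter My.
  move: yrsA; rewrite mem_filter => /andP[My yrs]; exists y => //.
  by rewrite /err My.
rewrite natrM -mulrA; apply: mu_bigcup_seq_le => y _; split=> //.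
rewrite /err; case: ifP => [My|/negbT nMy].
  by apply: minority_in_coset => //; exact: no_ladder_in.
rewrite -[A in _ `&` A]setCK -setDE; apply: minority_in_coset => //.
- exact: F_setC.
- exact: no_ladder_notin.
- move=> h Hh; have -> : [set x | (~` A) (x * h)%g] `\` ~` A = [set x | gap A x (1, h)%g].
    by apply/seteqP; split=> x; rewrite /gap /= mulg1 => -[? ?]; split=> //; apply: contrapT.
  by rewrite mu_gap mulg1 driftV; exact: drift_le.
rewrite -setDE; move: nMy; rewrite /maj -ltNge.
have : mu H = mu (lcoset_at y) by rewrite /lcoset_at mu_lshift.
by rewrite (mu_split (F_lcoset y) FA); lra.
Qed.

End Cosets.
(** Elements of Stab_m lie in Stab_m' with m' > m, so they have at most half of
    the permitted drift; this pays for the subadditivity. *)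
Lemma subgroup_Stab m m' : (m < m')%N ->
  (forall g, Stab mu m A g -> Stab mu m' A g) -> is_subgroup (Stab mu m A).
Proof.
move=> mm' stab.
have small g : Stab mu m A g -> drift g <= 2 ^- m.+2.
  move=> /stab/StabE/le_trans; apply.
  by rewrite lef_pV2 ?posrE ?exprn_gt0// ler_weXn2l ?ler1n.
split=> [|g h]; rewrite !inE => /=.
  by apply/StabE; rewrite drift1 invr_ge0 exprn_ge0.
move=> /small dg /small dh; apply/StabE; apply: le_trans (driftM _ _) _.
rewrite driftV; apply: le_trans (lerD dg dh) _.
by rewrite [in leLHS]exprS invfM; lra.
Qed.

(** A separated list of maximal length meets every coset. *)
Lemma coset_representatives m M : is_subgroup (Stab mu m A) ->
  (forall ys, uniq ys ->
     {in ys &, forall y y', y != y' -> ~ Stab mu m A (y^-1 * y')%g} ->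
     (size ys < M)%N) ->
  exists2 rs, (size rs < M)%N & forall g, exists2 y, y \in rs & Stab mu m A (y^-1 * g)%g.
Proof.
set H := Stab mu m A => subH bound.
have H1 : H 1%g by case: subH => + _; rewrite inE.
have HV x : H x -> H x^-1%g.
  by move=> Hx; have /(_ x) := group_closedV subH; rewrite !inE; apply.
pose sep n := `[< exists ys, [/\ uniq ys, size ys = n &
  {in ys &, forall y y', y != y' -> ~ H (y^-1 * y')%g}] >].
have sep0 : exists n, sep n by exists 0%N; apply/asboolP; exists [::].
have sepM n : sep n -> (n <= M)%N.
  by move=> /asboolP[ys [uys <- ysep]]; exact/ltnW/bound.
have [n /asboolP[rs [urs rsn rsep]] nmax] := ex_maxnP sep0 sepM.
exists rs; first exact: bound.
move=> g; apply: contrapT => ng.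
have nH y : y \in rs -> ~ H (y^-1 * g)%g by move=> yrs Hy; apply: ng; exists y.
suff /nmax : sep n.+1 by rewrite ltnn.
apply/asboolP; exists (g :: rs); split=> /=; last 2 first.
- by rewrite rsn.
- move=> y y'; rewrite !inE => /orP[/eqP->|yrs] /orP[/eqP->|y'rs].
  + by rewrite eqxx.
  + by move=> _ /HV; rewrite invgM invgK; exact: nH.
  + by move=> _; exact: nH.
  + exact: rsep.
by rewrite urs andbT; apply/negP => /nH; rewrite mulVg.
Qed.

Lemma Stab_gt0 m (rs : seq G) : F (Stab mu m A) ->
  (forall g, exists2 y, y \in rs & Stab mu m A (y^-1 * g)%g) -> 0 < mu (Stab mu m A).
Proof.
move=> FH cover; rewrite lt_neqAle mu_ge0// andbT eq_sym; apply/negP => /eqP H0.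
suff : (1 : R) <= (size rs)%:R * 0 by rewrite mulr0 ler10.
rewrite [leLHS](_ : _ = mu [set x | exists2 y, y \in rs & lcoset_at m y x]).
  by apply: mu_bigcup_seq_le => y _; rewrite mu_lshift// H0; split=> //; exact: F_lshift.
by rewrite -mu_setT; congr mu; apply/seteqP; split=> // g _; exact: cover.
Qed.

Lemma index_Stab m n (rs : seq G) : is_subgroup (Stab mu m A) -> (size rs <= n)%N ->
  (forall g, exists2 y, y \in rs & Stab mu m A (y^-1 * g)%g) ->
  index_at_most n (Stab mu m A).
Proof.
set H := Stab mu m A => subH rsn cover.
have HV x : H x -> H x^-1%g.
  by move=> Hx; have /(_ x) := group_closedV subH; rewrite !inE; apply.
have HM x y : H x -> H y -> H (x * y)%g.
  by move=> Hx Hy; have /(_ x y) := group_closedM subH; rewrite !inE; apply.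
apply: (@card_le_trans _ _ _ ((fun i => ltrans (nth 1%g rs i) H) @` `I_n)).
  apply: subset_card_le => C [g _ <-]; have [y yrs yg] := cover g.
  exists (index y rs); first by rewrite /= (leq_trans _ rsn)// index_mem.
  rewrite nth_index// !ltrans_Stab /lcoset_at.
  apply/seteqP; split=> x /= Hx.
    by have := HM _ _ (HV _ yg) Hx; rewrite invgM invgK mulgA mulgK.
  by have := HM _ _ yg Hx; rewrite mulgA mulgK.
exact: card_image_le.
Qed.

End Measure.

(** * Numerical bounds *)
Section Arithmetic.
Variables (k : nat) (k_gt1 : 1 < k).

Lemma Phi_const m : Phi k (fun=> m) =
  ramsey_s k * (5 + 2 * m + up_log 2 (ramsey_s k - 1)).
Proof.
rewrite /Phi; set c := 5 + _ + _.
suff it n : iter n (ftilde k (fun=> m)) 0 = n * c by exact: it.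
elim: n => //= n ->.
have fmaxE i : fmax (fun=> m) i = m.
  apply/eqP; rewrite eqn_leq; apply/andP; split; first exact/bigmax_leqP.
  exact: (leq_bigmax (F := fun _ : 'I_i.+1 => m) ord0).
by rewrite /ftilde fmaxE mulSn /c; lia.
Qed.

Lemma PsiC_homo m m' : m <= m' -> PsiC k m <= PsiC k m'.
Proof.
move=> mm'; rewrite /PsiC /Psi /omega !Phi_const leq_mul2l leq_exp2l//.
apply/orP; right; apply: leq_mul => //; apply: leq_mul => //.
by apply: leq_mul => //; lia.
Qed.

Lemma Phi_const_gt m : k < Phi k (fun=> m) /\ m < Phi k (fun=> m).
Proof.
have kK := ramsey_gt k_gt1; set K := ramsey k k.+1 in kK.
have sK : k <= ramsey_s k.
  have : (K - 1) ^ 2 < ramsey K K by apply: ramsey_gt_sqr; lia.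
  have : K - 1 <= (K - 1) ^ 2 by rewrite -[X in X <= _]expn1 leq_exp2l; lia.
  by rewrite /ramsey_s -/K; lia.
by rewrite Phi_const; split; nia.
Qed.

Lemma PsiC_ge m : 2 ^ (20 * Phi k (fun=> m) * (k - 1)) <= PsiC k m.
Proof.
by rewrite /PsiC /Psi /omega leq_pmull// expn_gt0; apply/orP; left; lia.
Qed.

(** L is chosen so that [packing] fails for 2^L elements, while 2^L still is below
    omega_{k-1}(Phi(C_m)). *)
Lemma packing_bound m (L := 20 * Phi k (fun=> m) * (k - 1)) :
  (2 ^ m.+1 * (2 * L).+1).+1 ^ (k - 1) < 2 ^ L.
Proof.
rewrite /L expnM ltn_exp2r ?subn_gt0//; set p := Phi k _.
have [kp mp] := Phi_const_gt m; rewrite -/p in kp mp.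
have p2 := ltn_expl p (isT : 1 < 2).
have m2 : 2 ^ m.+1 <= 2 ^ p by rewrite leq_exp2l.
have -> : 2 ^ (20 * p) = (2 ^ p) ^ 3 * 2 ^ (17 * p).
  by rewrite -expnM -expnD; congr (2 ^ _); lia.
have p17 : 2 ^ 17 <= 2 ^ (17 * p) by rewrite leq_exp2l//; lia.
set u := 2 ^ p in p2 m2 *; set w := 2 ^ m.+1 in m2 *.
have lin : (2 * (20 * p * (k - 1))).+1 <= 41 * u ^ 2.
  apply: (@leq_trans (41 * p ^ 2)); last by rewrite leq_mul2l leq_exp2r// ltnW.
  have : p * (k - 1) <= p * p by rewrite leq_mul2l; apply/orP; right; lia.
  by rewrite expnS expn1; nia.
have prod : w * (2 * (20 * p * (k - 1))).+1 <= u * (41 * u ^ 2) by exact: leq_mul.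
have u3 : 0 < u ^ 3 by rewrite expn_gt0; lia.
have {}prod : w * (2 * (20 * p * (k - 1))).+1 <= 41 * u ^ 3.
  by rewrite (leq_trans prod)// mulnCA -expnS.
apply: (@leq_trans (u ^ 3 * 2 ^ 17)); last by rewrite leq_mul2l p17 orbT.
have -> : 2 ^ 17 = 2 ^ 10 * 2 ^ 7 by rewrite -expnD.
have : u ^ 3 * (41 + 2) <= u ^ 3 * (2 ^ 10 * 2 ^ 7) by rewrite leq_mul2l orbT.
move: u3 prod; lia.
Qed.

Lemma multiplier_bound m : (2 * k.+1) ^ k.+1 <= 2 ^ (2 * up_log 2 (PsiC k m)).
Proof.
apply: (@leq_trans (2 ^ (k.+1 * k.+1))).
  rewrite expnM leq_exp2r// expnS leq_mul2l/=; exact: ltn_expl.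
rewrite leq_exp2l//; have [kp _] := Phi_const_gt m.
have : 20 * Phi k (fun=> m) * (k - 1) <= up_log 2 (PsiC k m).
  by rewrite -(leq_exp2l (m := 2))// (leq_trans (PsiC_ge m))// up_logP.
nia.
Qed.

(** In e_f the term with f pays for the precision, and 3 log Psi(C_m) pays once
    for the number of cosets and twice for the factor depending on k. *)
Lemma error_bound (f : nat -> nat -> nat) m r : r <= PsiC k m ->
  r * (2 * k.+1) ^ k.+1 * 2 ^ f (PsiC k m) m <= 2 ^ (ef k f m).+1.
Proof.
move=> rP; set P := PsiC k m in rP *.
have fP : f P m <= \max_(n < P.+1) f n m.
  exact: (leq_bigmax (F := fun n : 'I_P.+1 => f n m) ord_max).
have rl : r <= 2 ^ up_log 2 P by rewrite (leq_trans rP)// up_logP.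
apply: leq_trans (leq_mul (leq_mul rl (multiplier_bound m)) (leqnn _)) _.
rewrite -!expnD leq_exp2l// /ef -/P; set M := \max_(n < P.+1) f n m in fP *.
by rewrite ltnW// ltnS leq_max; apply/orP; left; lia.
Qed.

End Arithmetic.

Lemma kstable1 (G : groupType) (A : set G) : kstable 1 A -> A = set0.
Proof.
move=> stA; apply/seteqP; split=> // x Ax; apply: stA.
by exists (fun=> x), (fun=> 1%g) => i j; rewrite mulg1 !ord1.
Qed.

(** * Existence of a stabilizer with the required bounds *)

Theorem theorem4p4 (k : nat) (k_ge1 : 1 <= k) (f : nat -> nat -> nat)
    (R : realType) (G : groupType) (A : set G) (F : set (set G))
    (mu : set G -> R) :
  kstable k A ->
  biinvariant_algebra F -> F A ->
  biinvariant_probability F mu ->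
  exists n m : nat,
    [/\ n <= Psi1 k f,
        m <= Psi2 k f,
        F (Stab mu m A),
        is_subgroup (Stab mu m A) &
        index_at_most n (Stab mu m A)] /\
    (exists2 Y : set G, union_of_lcosets (Stab mu m A) Y &
       (mu (A `+` Y) <= 2 ^- (f n m))%R).
Proof.
move=> stA algF FA probmu; move: k_ge1; rewrite leq_eqVlt => /orP[/eqP k1|k_gt1].
  (* For k = 1 the set A is empty and its stabilizer is the whole group. *)
  rewrite -k1 in stA *; rewrite (kstable1 stA).
  have mu0 : mu (set0 `+` set0) = 0%R by rewrite setYK (mu_set0 algF probmu).
  have S0 : Stab mu 0 (set0 : set G) = setT.
    apply/seteqP; split=> // g _; rewrite /Stab /= /rtrans image_set0 mu0.
    by rewrite invr_ge0 exprn_ge0.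
  exists 1, 0; rewrite S0; split; first split.
  - by rewrite /Psi1 /PsiC /Psi /omega subnn !muln0 expn0.
  - by [].
  - exact: F_setT algF.
  - by split=> [|g h _ _]; rewrite inE.
  - rewrite /index_at_most (_ : lcosets_of _ = (fun=> setT) @` `I_1); first exact: card_image_le.
    have ltransT g : ltrans g setT = setT :> set G by rewrite -[g]invgK -lshiftE.
    apply/seteqP; split=> C [g _ <-]; first by exists 0.
    by exists 1%g.
  exists set0; first by exists set0 => //; rewrite bigcup_set0.
  by rewrite mu0 invr_ge0 exprn_ge0.
have [m mPhi stab] := metastable_Stab algF probmu FA k_gt1 stA (ef k f).
have mlt : m < ef k f m by rewrite /ef leq_max leqnn orbT.
have subH := subgroup_Stab algF probmu FA mlt stab.
have FH : F (Stab mu m A).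
  apply: (F_Stab algF probmu FA (K := ramsey k k.+1)) subH => a c lad.
  exact: kstable_gap lad.
(* The bound Psi(C_m) itself serves as n, so that the precision f(n, m) is known
   before the index. *)
set P := PsiC k m.
pose L := 20 * Phi k (fun=> m) * (k - 1).
have [ys uys ysep|rs rsL cover] := coset_representatives subH (M := 2 ^ L).
  rewrite ltnNge; apply/negP => Lys.
  have := packing algF probmu FA (m := m) (L := L) (ys := take (2 ^ L) ys) (ltnW k_gt1) stA.
  rewrite take_uniq// size_takel// leqNgt packing_bound//.
  move=> /(_ isT erefl) abs; apply: notF; apply: abs => y y' /mem_take yys /mem_take y'ys.
  exact: ysep.
have rsP : size rs <= P by rewrite (leq_trans (ltnW rsL))// PsiC_ge.
exists P, m; split; first split=> //.
- exact: PsiC_homo.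
- exact: (index_Stab subH rsP cover).
have drift_le h : Stab mu m A h -> (drift mu A h <= 2 ^- (ef k f m).+1)%R.
  by move=> /stab/(StabE algF probmu FA).
have H0 := Stab_gt0 algF probmu FH cover.
have [Y YH AY] := Stab_approximation algF probmu FA stA subH drift_le FH H0 cover.
exists Y => //; apply: le_trans AY _.
rewrite ler_pdivrMr ?exprn_gt0// mulrC ler_pdivlMr ?exprn_gt0//.
by rewrite -!natrX -natrM ler_nat error_bound.
Qed.
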